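(* Let $Q$ be a simple polygon with $m$ vertices, no three consecutive vertices collinear, with turning function $t_Q$ (with respect to any reference point). Then \[\mathrm{span}(t_Q)\le\left(\lfloor m/2\rfloor+1\right)\pi.\] Moreover the bound is tight: for any $\varepsilon>0$ there exists a polygon $P$ with at most $m$ vertices whose turning function $t_P$ satisfies $\mathrm{span}(t_P)\ge(\lfloor m/2\rfloor+1)\pi-\varepsilon$.
   Context: Let $P$ be a simple polygon scaled to have perimeter $1$, and fix a reference point $O$ on its boundary. The turning function $t_P:[0,1]\to\mathbb{R}$ assigns to $s$ the cumulative angle between the $x$-axis and the counterclockwise tangent to $P$ at the boundary point at counterclockwise arc-length distance $s$ from $O$: $t_P(0)\in[0,2\pi)$ is the angle of the tangent (the outgoing edge, if $O$ is a vertex) at $O$, and $t_P$ is constant along edges and at each vertex changes by the signed turning angle (increasing at left turns, decreasing at right turns, each of absolute value less than $\pi$). For $\phi:[0,1]\to\mathbb{R}$, $\mathrm{span}(\phi)=\max_{x\in[0,1]}\phi(x)-\min_{x\in[0,1]}\phi(x)$. *)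

(* Defs.v *)
From mathcomp Require Import all_boot all_order all_algebra.
From mathcomp Require Import all_classical all_reals all_analysis.

Set Implicit Arguments.
Unset Strict Implicit.
Unset Printing Implicit Defensive.

Import Order.TTheory GRing.Theory Num.Theory.

Local Open Scope classical_set_scope.
Local Open Scope ring_scope.

(* The library norm on [R * R] is the sup norm, hence [len] below. *)

Definition dot {R : realType} (u v : R * R) : R := u.1 * v.1 + u.2 * v.2.

Definition cross {R : realType} (u v : R * R) : R := u.1 * v.2 - u.2 * v.1.

Definition len {R : realType} (u : R * R) : R := Num.sqrt (dot u u).

Definition collinear {R : realType} (a b c : R * R) : Prop :=
  cross (b - a) (c - a) = 0.

(* Angle in [0, 2 pi) from the positive x-axis to u, for u != 0. *)
Definition direction {R : realType} (u : R * R) : R :=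
  if 0 <= u.2 then acos (u.1 / len u) else 2 * pi - acos (u.1 / len u).

(* Signed angle in (- pi, pi) from u to v, positive for a left turn; u and v
   are nonzero and not opposite, which holds for consecutive edges of a simple
   polygon. *)
Definition turn {R : realType} (u v : R * R) : R :=
  Num.sg (cross u v) * acos (dot u v / (len u * len v)).

(* A polygon is the cyclic sequence of its vertices [p : 'I_n -> R * R];
   [ordS] and [ord_pred] are the cyclic successor and predecessor on 'I_n. *)

Definition edge {R : realType} {n : nat} (p : 'I_n -> R * R) (i : 'I_n)
    : R * R :=
  p (ordS i) - p i.

Definition edge_point {R : realType} {n : nat} (p : 'I_n -> R * R)
    (i : 'I_n) (l : R) : R * R :=
  ((p i).1 + l * (edge p i).1, (p i).2 + l * (edge p i).2).

(* The half-open edges ([0 <= l < 1]) parametrize the closed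
   polygonal curve by one full turn, so injectivity says that the curve is a simple
   closed curve; it also forces the vertices to be distinct. *)
Definition simple_polygon {R : realType} {n : nat} (p : 'I_n -> R * R) : Prop :=
  (2 < n)%N /\
  forall (i j : 'I_n) (l k : R), 0 <= l < 1 -> 0 <= k < 1 ->
    edge_point p i l = edge_point p j k -> i = j /\ l = k.

Definition signed_area {R : realType} {n : nat} (p : 'I_n -> R * R) : R :=
  2^-1 * \sum_(i < n) cross (p i) (p (ordS i)).

Definition counterclockwise {R : realType} {n : nat} (p : 'I_n -> R * R)
    : Prop :=
  0 < signed_area p.

Definition perimeter {R : realType} {n : nat} (p : 'I_n -> R * R) : R :=
  \sum_(i < n) len (edge p i).

Definition vertex_turn {R : realType} {n : nat} (p : 'I_n -> R * R) (i : 'I_n)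
    : R :=
  turn (edge p (ord_pred i)) (edge p i).

(* Arc length, in the order of the vertices, from [edge_point p i l] to the
   vertex of index i + k + 1 (cyclically); the vertices met when going once
   around are those with k = 0, ..., n - 1, the last one being [p i]. *)
Definition vertex_dist {R : realType} {n : nat} (p : 'I_n -> R * R)
    (i : 'I_n) (l : R) (k : nat) : R :=
  (1 - l) * len (edge p i) +
  \sum_(1 <= j < k.+1) len (edge p (iter j (@ordS n) i)).

(* Turning function of a counterclockwise polygon of perimeter 1, with
   reference point [edge_point p i l], 0 <= l < 1: the direction of the edge
   leaving the reference point, plus the turns at the vertices met at arc length
   at most s.  Every boundary point of a simple polygon has a unique such
   (i, l).  When the reference point is the vertex [p i] (l = 0), the turn at
   [p i] is counted at s = 1 only, so the value at 1 always exceeds the value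
   at 0 by the total turning. *)
Definition turning_function {R : realType} {n : nat} (p : 'I_n -> R * R)
    (i : 'I_n) (l : R) (s : R) : R :=
  direction (edge p i) +
  \sum_(k < n | vertex_dist p i l k <= s)
     vertex_turn p (iter k.+1 (@ordS n) i).

(* A turning function takes finitely many values, so that the supremum and the
   infimum below are its maximum and minimum on [0, 1]. *)
Definition function_span {R : realType} (phi : R -> R) : R :=
  sup (phi @` `[0, 1]) - inf (phi @` `[0, 1]).

(* Main.v *)
Require Import Defs.
From mathcomp Require Import all_boot all_order all_algebra.
From mathcomp Require Import all_classical all_reals all_analysis.
From mathcomp Require Import ring lra zify.

Import Order.TTheory GRing.Theory Num.Theory.
Local Open Scope ring_scope.

(* Upper bound.  The turns of a simple polygon sum to 2 pi or - 2 pi, and each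
   is at most pi in absolute value.  So the sum over c of the n vertices is at
   most c pi, and, passing to the complement, at most (n - c + 2) pi; the smaller
   of the two is at most (n / 2 + 1) pi.  The total turning is computed by a
   discrete form of Hopf's argument on the secants q_j - q_i, i < j: around a
   cell (i, j) of the index triangle the secants stay in an open half-plane, so
   their turns cancel, and the turning along the diagonal (the edges) equals that
   along the legs (the chords from one vertex).

   Tightness.  Compressing the y-axis of a fixed simple polygon makes every turn
   that reverses the x-direction tend to pi or - pi.  It remains to find a simple
   polygon with 2 k vertices and k + 1 consecutive x-reversing left turns: a spiral
   with k edges, doubled so that the two copies share their endpoints. *)

(** * Turning angles *)

Section Turn.
Context {R : realType}.
Implicit Types u v w : R * R.

Lemma crossC u v : cross v u = - cross u v.
Proof. by rewrite /cross; ring. Qed.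

Lemma dotC u v : dot v u = dot u v.
Proof. by rewrite /dot; ring. Qed.

Lemma dot_ge0 u : 0 <= dot u u.
Proof. by rewrite /dot -!expr2 addr_ge0 ?sqr_ge0. Qed.

Lemma dot_eq0 u : dot u u = 0 -> u = 0.
Proof.
case: u => a b /eqP; rewrite /dot /= -!expr2 paddr_eq0 ?sqr_ge0 // !sqrf_eq0.
by move=> /andP[/eqP -> /eqP ->].
Qed.

Lemma len_ge0 u : 0 <= len u.
Proof. exact: sqrtr_ge0. Qed.

Lemma len_gt0 u : u != 0 -> 0 < len u.
Proof.
move=> u0; rewrite sqrtr_gt0 lt_def dot_ge0 andbT.
by apply: contra u0 => /eqP /dot_eq0 ->.
Qed.

Lemma sqr_len u : len u ^+ 2 = dot u u.
Proof. by rewrite sqr_sqrtr ?dot_ge0. Qed.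

Lemma lagrange_identity u v :
  dot u v ^+ 2 + cross u v ^+ 2 = (len u * len v) ^+ 2.
Proof. by rewrite exprMn !sqr_len /dot /cross; ring. Qed.

Lemma cos_vec_sqr u v : u != 0 -> v != 0 ->
  1 - (dot u v / (len u * len v)) ^+ 2 = (cross u v / (len u * len v)) ^+ 2.
Proof.
move=> /len_gt0 u0 /len_gt0 v0; have k0 : len u * len v != 0.
  by rewrite mulf_neq0 ?gt_eqF.
apply/eqP; rewrite subr_eq addrC !expr_div_n -mulrDl lagrange_identity.
by rewrite divff // expf_neq0.
Qed.

Lemma cos_vec_bound u v : -1 <= dot u v / (len u * len v) <= 1.
Proof.
have [->|u0] := eqVneq u 0; first by rewrite /dot /= !mul0r add0r mul0r lerN10 ler01.
have [->|v0] := eqVneq v 0; first by rewrite /dot /= !mulr0 add0r mul0r lerN10 ler01.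
have := cos_vec_sqr u v u0 v0; set c := dot _ _ / _; set s := cross _ _ / _ => E.
have : 0 <= s ^+ 2 by exact: sqr_ge0.
by rewrite -E => ?; nra.
Qed.

(** The domain where [turn] is a genuine angle strictly between - pi and pi: zero vectors and
    opposite directions fail both disjuncts. *)
Definition not_antiparallel u v := (cross u v != 0) || (0 < dot u v).

Lemma not_antiparallelC u v : not_antiparallel v u = not_antiparallel u v.
Proof. by rewrite /not_antiparallel crossC oppr_eq0 dotC. Qed.

Lemma not_antiparallel_neq0 u v : not_antiparallel u v -> u != 0 /\ v != 0.
Proof.
move=> h; split; apply/eqP => e; move: h; rewrite /not_antiparallel /cross /dot e /=.
  by rewrite !mul0r subr0 addr0 eqxx ltxx.
by rewrite !mulr0 subr0 addr0 eqxx ltxx.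
Qed.

Lemma cos_turn u v : not_antiparallel u v ->
  cos (turn u v) = dot u v / (len u * len v).
Proof.
move=> h; have [u0 v0] := not_antiparallel_neq0 u v h.
have l0 : 0 < len u * len v by rewrite mulr_gt0 ?len_gt0.
rewrite /turn; have [c0|c0] := eqVneq (cross u v) 0.
  rewrite c0 sgr0 mul0r cos0.
  move: h; rewrite /not_antiparallel c0 eqxx /= => d0.
  have := lagrange_identity u v; rewrite c0 expr0n addr0 => /eqP.
  by rewrite eqrXn2 ?(ltW d0) ?(ltW l0) // => /eqP ->; rewrite divff ?gt_eqF.
by rewrite cos_sg // acosK // in_itv /= cos_vec_bound.
Qed.

Lemma sin_turn u v : not_antiparallel u v ->
  sin (turn u v) = cross u v / (len u * len v).
Proof.
move=> h; have [u0 v0] := not_antiparallel_neq0 u v h.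
have l0 : 0 < len u * len v by rewrite mulr_gt0 ?len_gt0.
rewrite /turn; have [c0|c0] := eqVneq (cross u v) 0.
  by rewrite c0 sgr0 !mul0r sin0.
rewrite sin_sg sin_acos ?cos_vec_bound // cos_vec_sqr // sqrtr_sqr.
by rewrite normrM (ger0_norm (x := (_)^-1)) ?invr_ge0 ?ltW // mulrA -numEsg.
Qed.

Lemma turn_le_pi u v : `|turn u v| <= pi.
Proof.
rewrite /turn normrM normr_sg ger0_norm ?acos_ge0 ?cos_vec_bound //.
have := acos_lepi (cos_vec_bound u v); have := @pi_ge0 R.
by case: (cross u v != 0) => /=; rewrite ?mul1r ?mul0r.
Qed.

Lemma turn_lt_pi u v : not_antiparallel u v -> `|turn u v| < pi.
Proof.
move=> h; rewrite lt_neqAle turn_le_pi andbT; apply/eqP => e.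
have := sin_turn u v h; have := cos_turn u v h.
have [c s] : cos (turn u v) = -1 /\ sin (turn u v) = 0.
  rewrite -(cos_norm (turn u v)) e cospi; split => //.
  by move: e; have [_ ->|_ /eqP] := ger0P (turn u v);
    rewrite ?sinpi // eqr_oppLR => /eqP ->; rewrite sinN sinpi oppr0.
rewrite c s => dE /esym /eqP; have [/len_gt0 u0 /len_gt0 v0] := not_antiparallel_neq0 u v h.
have l0 : 0 < len u * len v by rewrite mulr_gt0.
rewrite mulf_eq0 invr_eq0 (gt_eqF l0) orbF => c0.
move: h; rewrite /not_antiparallel c0 /= => d0.
have : 0 < dot u v / (len u * len v) by rewrite divr_gt0.
by rewrite -dE oppr_gt0 ltr10.
Qed.

Lemma turnN u v : turn (- u) (- v) = turn u v.
Proof.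
have E w : len (- w) = len w by rewrite /len /dot /= !mulrNN.
by rewrite /turn !E /cross /dot /= !mulrNN.
Qed.

Lemma turnC u v : turn v u = - turn u v.
Proof. by rewrite /turn crossC sgrN mulNr dotC (mulrC (len v)). Qed.

Lemma turn_gt0 u v : 0 < cross u v -> 0 < turn u v.
Proof.
move=> c0; have h : not_antiparallel u v by rewrite /not_antiparallel gt_eqF.
have [/len_gt0 u0 /len_gt0 v0] := not_antiparallel_neq0 u v h.
have := sin_turn u v h; have := turn_lt_pi u v h; rewrite /turn gtr0_sg // mul1r.
set a := acos _ => ap sa; rewrite lt_def acos_ge0 ?cos_vec_bound // andbT.
apply/eqP => a0; move: sa; rewrite a0 sin0 => /esym /eqP.
by rewrite mulf_eq0 invr_eq0 mulf_eq0 !gt_eqF.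
Qed.

(** cos y = 1 forces sin (y / 2) = 0, and on [0, 3 pi / 2) sine vanishes only at 0 and pi. The range
    3 pi is that of a sum of three turns. *)
Lemma cos_eq1_lt3pi (x : R) : cos x = 1 -> `|x| < 3 * pi ->
  [\/ x = 0, x = 2 * pi | x = - (2 * pi)].
Proof.
have H (y : R) : cos y = 1 -> 0 <= y -> y < 3 * pi -> y = 0 \/ y = 2 * pi.
  move=> cy y0 y3; have p0 := @pi_gt0 R.
  have s0 : sin (y / 2) = 0.
    move: cy; rewrite {1}[y](splitr y) -mulr2n cos_mulr2n cos2sin2 => cy.
    by apply/eqP; rewrite -sqrf_eq0; apply/eqP; lra.
  have [y2|y2|->] := ltgtP y (2 * pi); [left|exfalso|by right].
    apply/eqP; move: y0; rewrite le_eqVlt eq_sym => /orP[//|y0].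
    by have : 0 < sin (y / 2) by [apply: sin_gt0_pi; lra]; rewrite s0 ltxx.
  have : 0 < sin (y / 2 - pi) by [apply: sin_gt0_pi; lra].
  by rewrite -oppr_lt0 -sinDpi subrK s0 ltxx.
move=> cx x3; have [x0|x0] := ger0P x.
  rewrite ger0_norm // in x3.
  by case: (H x cx x0 x3) => ->; [exact: Or31|exact: Or32].
rewrite ltr0_norm // in x3.
case: (H (- x)) => //; rewrite ?cosN ?oppr_ge0 ?ltW // => e.
  by apply: Or31; lra.
by apply: Or33; lra.
Qed.

(** In complex terms, the product of conj(u) v, conj(v) w and conj(w) u is the positive real |u|^2
    |v|^2 |w|^2, so the three arguments add up to a multiple of 2 pi. *)
Lemma turn_sum3_cases u v w :
  not_antiparallel u v -> not_antiparallel v w -> not_antiparallel w u ->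
  [\/ turn u v + turn v w + turn w u = 0,
      turn u v + turn v w + turn w u = 2 * pi
    | turn u v + turn v w + turn w u = - (2 * pi)].
Proof.
move=> huv hvw hwu; apply: cos_eq1_lt3pi; last first.
  apply: le_lt_trans (ler_normD _ _) _.
  have := turn_lt_pi _ _ hwu; have := turn_lt_pi _ _ huv.
  have := turn_lt_pi _ _ hvw; have := ler_normD (turn u v) (turn v w); lra.
have [/len_gt0 u0 /len_gt0 v0] := not_antiparallel_neq0 u v huv.
have [_ /len_gt0 w0] := not_antiparallel_neq0 v w hvw.
rewrite cosD cosD sinD !cos_turn // !sin_turn //.
have E : (dot u v * dot v w - cross u v * cross v w) * dot w u -
    (cross u v * dot v w + dot u v * cross v w) * cross w u =
    len u ^+ 2 * len v ^+ 2 * len w ^+ 2.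
  by rewrite !sqr_len /dot /cross; ring.
have N : len u ^+ 2 * len v ^+ 2 * len w ^+ 2 != 0.
  by rewrite !mulf_neq0 ?expf_neq0 ?gt_eqF.
rewrite -[RHS](divff N) -{1}E.
move: (gt_eqF u0) (gt_eqF v0) (gt_eqF w0) => /negbT lu /negbT lv /negbT lw.
move: (dot u v) (dot v w) (dot w u) (cross u v) (cross v w) (cross w u).
move: (len u) (len v) (len w) lu lv lw => x y z lu lv lw d1 d2 d3 c1 c2 c3.
by field; rewrite lu lv lw.
Qed.

(* The hypothesis says that 0 is not in the convex hull of u, v and w. *)
Lemma turn_triangle u v w :
  (forall a b c : R, 0 <= a -> 0 <= b -> 0 <= c ->
     a *: u + b *: v + c *: w = 0 -> a + b + c = 0) ->
  turn u v + turn v w = turn u w.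
Proof.
move=> H.
have comb a b c : 0 <= a -> 0 <= b -> 0 <= c ->
    a * u.1 + b * v.1 + c * w.1 = 0 -> a * u.2 + b * v.2 + c * w.2 = 0 ->
    a + b + c = 0.
  move=> a0 b0 c0 e1 e2; apply: H => //.
  by apply/eqP; rewrite /eq_op /=; apply/andP; split; apply/eqP.
have nz x y : x + y = 0 :> R -> 0 <= x -> 0 <= y -> x = 0.
  by move=> ? ? ?; lra.
have nap x y : (forall a b, 0 <= a -> 0 <= b ->
     a * x.1 + b * y.1 = 0 -> a * x.2 + b * y.2 = 0 -> a + b = 0) ->
     not_antiparallel x y.
  move=> K; rewrite /not_antiparallel; case: eqP => //= c0; rewrite ltNge; apply/negP => d0.
  (* For parallel x and y with [dot x y <= 0], (dot y y) x - (dot x y) y = 0 is a combination with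
     nonnegative coefficients. *)
  have : dot y y + - dot x y = 0.
    apply: K; rewrite ?dot_ge0 ?oppr_ge0 //.
      transitivity (- (cross x y) * y.2 * (-1)); last by rewrite c0; ring.
      by rewrite /dot /cross; ring.
    transitivity (- (cross x y) * y.1); last by rewrite c0; ring.
    by rewrite /dot /cross; ring.
  move=> /nz; rewrite dot_ge0 oppr_ge0 d0 => /(_ isT isT) /dot_eq0 y0.
  have := K 0 1; rewrite y0 /= !mul0r mulr0 addr0 add0r.
  by move=> /(_ (lexx _) ler01 erefl erefl) /eqP; rewrite oner_eq0.
have huv : not_antiparallel u v.
  by apply: nap => a b a0 b0 e1 e2; have := comb a b 0; lra.
have hvw : not_antiparallel v w.
  by apply: nap => a b a0 b0 e1 e2; have := comb 0 a b; lra.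
have hwu : not_antiparallel w u.
  by apply: nap => a b a0 b0 e1 e2; have := comb b 0 a; lra.
(* 0 is a combination of u, v, w with the cross products as coefficients, so these cannot all have
   the same strict sign. A sum of turns equal to 2 pi or - 2 pi would give all three turns, hence
   all three cross products, one strict sign. *)
have bary1 : cross v w * u.1 + cross w u * v.1 + cross u v * w.1 = 0.
  by rewrite /cross; ring.
have bary2 : cross v w * u.2 + cross w u * v.2 + cross u v * w.2 = 0.
  by rewrite /cross; ring.
have pos : ~ (0 < cross u v /\ 0 < cross v w /\ 0 < cross w u).
  by move=> [a [b c]]; have := comb _ _ _ (ltW b) (ltW c) (ltW a) bary1 bary2; lra.
have neg : ~ (cross u v < 0 /\ cross v w < 0 /\ cross w u < 0).
  move=> [a [b c]]; have := comb (- cross v w) (- cross w u) (- cross u v).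
  by rewrite !mulNr -!opprD bary1 bary2 !oppr_ge0 !oppr0 !ltW // => /(_ isT isT isT erefl erefl); lra.
have sgn x y : not_antiparallel x y -> 0 < turn x y -> 0 < cross x y.
  move=> h t; have [|//|c0] := ltgtP (cross x y) 0.
    by rewrite -oppr_gt0 -crossC => /turn_gt0; rewrite turnC; lra.
  by move: t; rewrite /turn c0 sgr0 mul0r ltxx.
have sgn' x y : not_antiparallel x y -> turn x y < 0 -> cross x y < 0.
  by move=> h t; rewrite -oppr_gt0 -crossC; apply: sgn;
    rewrite 1?not_antiparallelC // turnC oppr_gt0.
have := turn_lt_pi _ _ huv; have := turn_lt_pi _ _ hvw; have := turn_lt_pi _ _ hwu.
rewrite !ltr_norml => /andP[a1 a2] /andP[b1 b2] /andP[c1 c2].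
have [E|E|E] := turn_sum3_cases u v w huv hvw hwu.
- by rewrite (turnC w u); lra.
- by exfalso; apply: pos; split; [|split]; apply: sgn => //; lra.
- by exfalso; apply: neg; split; [|split]; apply: sgn' => //; lra.
Qed.

Lemma turn_half_plane n u v w : 0 < dot n u -> 0 < dot n v -> 0 < dot n w ->
  turn u v + turn v w = turn u w.
Proof.
move=> hu hv hw; apply: turn_triangle => a b c a0 b0 c0 E.
have {}E : a * dot n u + b * dot n v + c * dot n w = 0.
  transitivity (dot n (a *: u + b *: v + c *: w)).
    by rewrite /dot /= /GRing.scale /=; ring.
  by rewrite E /dot /= !mulr0 addr0.
have := mulr_ge0 a0 (ltW hu); have := mulr_ge0 b0 (ltW hv).
have := mulr_ge0 c0 (ltW hw) => p q r.
have z x y : 0 < y -> x * y = 0 -> x = 0 :> R.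
  by move=> y0 /eqP; rewrite mulf_eq0 (gt_eqF y0) orbF => /eqP.
have -> : a = 0 by apply: z hu _; lra.
have -> : b = 0 by apply: z hv _; lra.
have -> : c = 0 by apply: z hw _; lra.
by rewrite !addr0.
Qed.

(** By independence of u and v, a u + b (u + v) + c v = 0 gives a + b = b + c = 0, so 0 is outside
    the hull. *)
Lemma turn_add u v : cross u v != 0 -> turn u (u + v) + turn (u + v) v = turn u v.
Proof.
move=> c0; apply: turn_triangle => a b c a0 b0 c0' E.
have E1 : (a + b) * u.1 + (b + c) * v.1 = 0.
  by move: (congr1 fst E); rewrite /= /GRing.scale /= => <-; ring.
have E2 : (a + b) * u.2 + (b + c) * v.2 = 0.
  by move: (congr1 snd E); rewrite /= /GRing.scale /= => <-; ring.
have F1 : (a + b) * cross u v = 0.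
  transitivity (((a + b) * u.1 + (b + c) * v.1) * v.2 - ((a + b) * u.2 + (b + c) * v.2) * v.1).
    by rewrite /cross; ring.
  by rewrite E1 E2; ring.
have F2 : (b + c) * cross u v = 0.
  transitivity (- ((a + b) * u.1 + (b + c) * v.1) * u.2 + ((a + b) * u.2 + (b + c) * v.2) * u.1).
    by rewrite /cross; ring.
  by rewrite E1 E2; ring.
move: F1 F2 => /eqP; rewrite mulf_eq0 (negbTE c0) orbF => /eqP F1 /eqP.
by rewrite mulf_eq0 (negbTE c0) orbF => /eqP F2; lra.
Qed.

(** The angles from u to v and from u to - v are supplementary, as acos (- x) = pi - acos x, and
    have opposite signs. *)
Lemma turn_opposite u v : cross u v != 0 -> `|turn u (- v) + turn v u| = pi.
Proof.
move=> c0; rewrite (turnC u v) /turn.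
have -> : cross u (- v) = - cross u v by rewrite /cross /=; ring.
have -> : dot u (- v) = - dot u v by rewrite /dot /=; ring.
have -> : len (- v) = len v by rewrite /len /dot /= !mulrNN.
rewrite mulNr acosN ?cos_vec_bound // sgrN.
set a := acos _; have -> : - Num.sg (cross u v) * (pi - a) - Num.sg (cross u v) * a =
  - (Num.sg (cross u v) * pi) by ring.
by rewrite normrN normrM normr_sg c0 mul1r ger0_norm ?pi_ge0.
Qed.

End Turn.

(** * Rotation of secants *)

Section Rotation.
Context {R : realType}.

(** [h i j] stands for the turning along the step from (i, j) to (i + 1, j), [v i j] for that to (i,
    j + 1). Adding the relations of the cells of one row cancels the sides that they share. *)
Lemma grid_row_sum (h v : nat -> nat -> R) (J r : nat) :
  (forall i, (i.+1 < J)%N -> v i J + h i J.+1 = h i J + v i.+1 J) ->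
  (r < J)%N ->
  \sum_(i < r) h i J + v r J = v 0%N J + \sum_(i < r) h i J.+1.
Proof.
move=> H; elim: r => [|r IH] rJ; first by rewrite !big_ord0 add0r addr0.
have := IH (ltnW rJ); have := H r rJ; rewrite !big_ord_recr /=.
by move: (\sum_(i < r) _) (\sum_(i < r) _) => a b; lra.
Qed.

(* Additivity over cells: the turning along the diagonal of the triangle
   [i < j <= n] equals the turning along its two legs. *)
Lemma grid_sum (h v : nat -> nat -> R) (t : nat -> R) (n m : nat) :
  (forall i, (i.+1 < n)%N -> v i i.+1 + h i i.+2 = t i.+1) ->
  (forall i j, (i.+1 < j)%N -> (j < n)%N -> v i j + h i j.+1 = h i j + v i.+1 j) ->
  (m < n)%N ->
  \sum_(i < m) t i.+1 = \sum_(i < m) v 0%N i.+1 + \sum_(i < m) h i m.+1.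
Proof.
move=> D C; elim: m => [|m IH] mn; first by rewrite !big_ord0 addr0.
have := IH (ltnW mn); have := D m mn.
(* The row from level m + 1 to level m + 2 consists of the cells i < m and is closed at the diagonal
   by [D m]. *)
have := grid_row_sum h v m.+1 m (fun i im => C i m.+1 im mn) (ltnSn m).
rewrite !big_ord_recr /=.
move: (\sum_(i < m) _) (\sum_(i < m) _) (\sum_(i < m) _) (\sum_(i < m) _) => a b c d; lra.
Qed.

Lemma turn0r (u : R * R) : turn u 0 = 0.
Proof. by rewrite /turn /cross /= !mulr0 subr0 sgr0 mul0r. Qed.

(** The vectors d + t v - s u are the differences of points of two edges. When the edges are
    disjoint, 0 is outside this parallelogram, hence outside both triangles cut off by the diagonal
    from d to d + v - u, and both sides equal the turn along that diagonal. *)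
Lemma turn_parallelogram (d u v : R * R) :
  (forall s t : R, 0 <= s <= 1 -> 0 <= t <= 1 -> d + t *: v - s *: u <> 0) ->
  turn d (d + v) + turn (d + v) (d + v - u) = turn d (d - u) + turn (d - u) (d + v - u).
Proof.
move=> H.
have K (a b c : R) : 0 <= a -> 0 <= b -> 0 <= c ->
   (a + b + c) *: d + (b + c) *: v - c *: u = 0 -> a + b + c = 0.
  move=> a0 b0 c0 E; apply/eqP; rewrite -[_ == _]negbK; apply/negP => s0.
  have sp : 0 < a + b + c by rewrite lt_def s0 !addr_ge0.
  apply: (H (c / (a + b + c)) ((b + c) / (a + b + c))).
  - by rewrite divr_ge0 ?(ltW sp) // ler_pdivrMr // mul1r; lra.
  - by rewrite divr_ge0 ?(ltW sp) ?addr_ge0 // ler_pdivrMr // mul1r; lra.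
  have /(congr1 ( *:%R (a + b + c)^-1)) := E.
  by rewrite scaler0 scalerBr scalerDr !scalerA mulVf // scale1r !(mulrC (_^-1)).
have K' (a b c : R) : 0 <= a -> 0 <= b -> 0 <= c ->
   (a + b + c) *: d + c *: v - (b + c) *: u = 0 -> a + b + c = 0.
  move=> a0 b0 c0 E; apply/eqP; rewrite -[_ == _]negbK; apply/negP => s0.
  have sp : 0 < a + b + c by rewrite lt_def s0 !addr_ge0.
  apply: (H ((b + c) / (a + b + c)) (c / (a + b + c))).
  - by rewrite divr_ge0 ?(ltW sp) ?addr_ge0 // ler_pdivrMr // mul1r; lra.
  - by rewrite divr_ge0 ?(ltW sp) // ler_pdivrMr // mul1r; lra.
  have /(congr1 ( *:%R (a + b + c)^-1)) := E.
  by rewrite scaler0 scalerBr scalerDr !scalerA mulVf // scale1r !(mulrC (_^-1)).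
rewrite !turn_triangle //.
- move=> a b c a0 b0 c0 E; apply: K' => //; rewrite -[RHS]E.
  by rewrite !scalerDl !scalerDr !scalerN; ring.
- move=> a b c a0 b0 c0 E; apply: K => //; rewrite -[RHS]E.
  by rewrite !scalerDl !scalerDr !scalerN; ring.
Qed.

(* Hopf's homotopy of secants: the secants q_j - q_i, i < j, turn along the
   diagonal of the triangle as the edges do, and along its legs as the chords
   from q_0 do; the latter stay in an open half-plane when q_0 is extremal. *)
Lemma turning_number_at_extremal (q : nat -> R * R) (w : R * R) (N : nat)
    (e := fun j => q j.+1 - q j) :
  (0 < N)%N -> q N.+2 = q 0%N ->
  (forall i j (l k : R), (i < N.+2)%N -> (j < N.+2)%N -> 0 <= l < 1 -> 0 <= k < 1 ->
     q i + l *: e i = q j + k *: e j -> i = j) ->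
  (forall j, (j <= N)%N -> cross (e j) (e j.+1) != 0) ->
  cross (e N.+1) (e 0%N) != 0 ->
  (forall j, (0 < j)%N -> (j < N.+2)%N -> 0 < dot w (q j - q 0%N)) ->
  `|\sum_(j < N.+1) turn (e j) (e j.+1) + turn (e N.+1) (e 0%N)| = 2 * pi.
Proof.
move=> N0 qN simple noncol noncol0 half.
pose v i j := turn (q j - q i) (q j.+1 - q i).
(* The secant at (0, N + 2) is q_(N+2) - q_0 = 0, so the two sides of the cell (0, N + 1) that end
   there have turn 0 by default. The extra term, the turn at q_0, restores additivity on this
   cell. *)
pose h i j := turn (q j - q i) (q j - q i.+1) +
  (if (i == 0%N) && (j == N.+2) then turn (e N.+1) (e 0%N) else 0).
pose t j := turn (e j.-1) (e j).
have D i : (i.+1 < N.+2)%N -> v i i.+1 + h i i.+2 = t i.+1.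
  move=> iN; rewrite /v /h /t /=.
  have -> : ((i == 0%N) && (i.+2 == N.+2)) = false by lia.
  rewrite addr0 -[RHS]turn_add ?noncol //.
  suff -> : e i + e i.+1 = q i.+2 - q i by [].
  by rewrite /e addrC addrA subrK.
(* Simplicity concerns half-open edges. The point of parameter 1 is the point of parameter 0 of the
   cyclically next edge, so nonadjacent closed edges are disjoint too. *)
have closed i j (l k : R) : (i.+1 < j)%N -> (j < N.+2)%N -> ~~ ((i == 0%N) && (j == N.+1)) ->
    0 <= l <= 1 -> 0 <= k <= 1 -> q i + l *: e i <> q j + k *: e j.
  move=> ij jN nij /andP[l0 l1] /andP[k0 k1] E.
  have norm a (x : R) : (a < N.+2)%N -> 0 <= x -> x <= 1 -> exists2 b, (b = a \/ b = a.+1 /\ (b < N.+2)%N \/ b = 0%N /\ a = N.+1) &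
      exists2 y, 0 <= y < 1 & q a + x *: e a = q b + y *: e b.
    move=> aN x0; rewrite le_eqVlt => /orP[/eqP ->|x1].
      have -> : q a + 1 *: e a = q a.+1 by rewrite scale1r /e addrC subrK.
      have [aN'|aN'] := ltnP a.+1 N.+2.
        by exists a.+1; [right; left|exists 0; rewrite ?lexx ?ltr01 // scale0r addr0].
      have -> : a = N.+1 by lia.
      by exists 0%N; [right; right|exists 0; rewrite ?lexx ?ltr01 // scale0r addr0 qN].
    by exists a; [left|exists x; rewrite // x0].
  have iN : (i < N.+2)%N by lia.
  have [b Hb [y yb Eb]] := norm i l iN l0 l1.
  have [c Hc [z zc Ec]] := norm j k jN k0 k1.
  have bN : (b < N.+2)%N by lia.
  have cN : (c < N.+2)%N by lia.
  rewrite Eb Ec in E; have := simple b c y z bN cN yb zc E.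
  lia.
have C i j : (i.+1 < j)%N -> (j < N.+2)%N -> v i j + h i j.+1 = h i j + v i.+1 j.
  move=> ij jN; rewrite /h.
  have -> : ((i == 0%N) && (j == N.+2)) = false by lia.
  have [/andP[/eqP i0 /eqP jN1]|nij] := boolP ((i == 0%N) && (j == N.+1)).
    rewrite i0 jN1 /= addr0 /v qN subrr turn0r.
    have -> : turn 0 (q 0%N - q 1%N) = 0 by rewrite turnC turn0r oppr0.
    rewrite !add0r.
    have -> : q N.+1 - q 0%N = - e N.+1 by rewrite /e qN opprB.
    have -> : q 0%N - q 1%N = - e 0%N by rewrite /e opprB.
    have -> : q N.+1 - q 1%N = - e N.+1 - e 0%N.
      by rewrite /e qN !opprB addrA subrK.
    by rewrite -opprD !turnN turn_add.
  rewrite !addr0 /v.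
  have -> : q j.+1 - q i = (q j - q i) + e j by rewrite /e; ring.
  have -> : q j.+1 - q i.+1 = (q j - q i) + e j - e i.
    by rewrite /e; ring.
  have -> : q j - q i.+1 = (q j - q i) - e i by rewrite /e; ring.
  apply: turn_parallelogram => s x s01 x01 E.
  apply: (closed i j s x) => //; apply/eqP; rewrite -subr_eq0; apply/eqP.
  by rewrite -oppr0 -E; ring.
have := grid_sum h v t N.+2 N.+1 D C (ltnSn _).
(* The chords from q_0 stay in the half-plane of w, so their turns telescope. *)
have T r : (r <= N)%N -> \sum_(i < r) v 0%N i.+1 = turn (e 0%N) (q r.+1 - q 0%N).
  elim: r => [_|r IH rN].
    by rewrite big_ord0 /e /turn /cross (mulrC (q 1%N - q 0%N).1) subrr sgr0 mul0r.
  rewrite big_ord_recr /= IH ?(ltnW rN) // /v.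
  by apply: (turn_half_plane w); rewrite ?/e; apply: half; lia.
have vE : \sum_(i < N.+1) v 0%N i.+1 = turn (e 0%N) (- e N.+1).
  by rewrite big_ord_recr /= T // /v qN subrr turn0r addr0 /e qN opprB.
(* Here the secants are q_0 - q_i, opposite to the chords of the other leg, so they turn equally;
   the term i = 0 contributes the added turn at q_0. *)
have hE : \sum_(i < N.+1) h i N.+2 = turn (e 0%N) (- e N.+1) + turn (e N.+1) (e 0%N).
  rewrite big_ord_recl /= {1}/h !eqxx /= qN subrr [turn 0 _]turnC turn0r oppr0 add0r.
  rewrite addrC; congr (_ + _).
  rewrite [RHS](_ : _ = turn (e 0%N) (q N.+1 - q 0%N)); last by rewrite /e qN opprB.
  rewrite -T //; apply: eq_bigr => i _; rewrite /h /= addr0 qN /v.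
  by rewrite /bump /= -turnN !opprB.
rewrite vE hE => ->.
(* The total is twice the sum of one leg and the turn at q_0, which is a half-turn. *)
have := turn_opposite (e 0%N) (e N.+1); rewrite crossC oppr_eq0 => /(_ noncol0) E.
rewrite (_ : _ + _ + _ = 2 * (turn (e 0%N) (- e N.+1) + turn (e N.+1) (e 0%N))); last by ring.
by rewrite normrM E ger0_norm.
Qed.

End Rotation.

(** * The upper bound *)

Section UpperBound.
Context {R : realType}.

Lemma val_iter_ordS n (i : 'I_n) k : iter k (@ordS n) i = ((i + k) %% n)%N :> nat.
Proof.
elim: k => [|k IH]; first by rewrite addn0 modn_small.
by rewrite iterS /= IH -addn1 modnDml addn1 addnS.
Qed.

Lemma iter_ordS_inj n (i : 'I_n) j k : (j < n)%N -> (k < n)%N ->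
  iter j (@ordS n) i = iter k (@ordS n) i -> j = k.
Proof.
move=> jn kn /(congr1 val); rewrite /= !val_iter_ordS => /eqP.
by rewrite eqn_modDl !modn_small // => /eqP.
Qed.

Lemma iter_ordS_order n (i : 'I_n) : iter n (@ordS n) i = i.
Proof. by apply: val_inj; rewrite /= val_iter_ordS modnDr modn_small. Qed.

Lemma sum_iter_ordS n (i : 'I_n) (F : 'I_n -> R) :
  \sum_(k < n) F (iter k.+1 (@ordS n) i) = \sum_j F j.
Proof.
have inj : injective (fun k : 'I_n => iter k.+1 (@ordS n) i).
  move=> j k E; apply: val_inj; apply: (iter_ordS_inj n i); rewrite ?(valP j) ?(valP k) //.
  exact: (@ordS_inj n _ _ E).
by rewrite [RHS](reindex_inj inj).
Qed.

Lemma vertex_turn_ordS n (p : 'I_n -> R * R) (i : 'I_n) :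
  vertex_turn p (ordS i) = turn (edge p i) (edge p (ordS i)).
Proof. by rewrite /vertex_turn ordSK. Qed.

Lemma edge_pointE n (p : 'I_n -> R * R) (i : 'I_n) (l : R) :
  edge_point p i l = p i + l *: edge p i.
Proof. by []. Qed.

Lemma simple_polygon_inj n (p : 'I_n -> R * R) : simple_polygon p -> injective p.
Proof.
move=> [_ H] i j E; have b01 : 0 <= (0 : R) < 1 by rewrite lexx ltr01.
by have [] := H i j 0 0 b01 b01; rewrite // !edge_pointE !scale0r !addr0.
Qed.

Lemma total_turn n (p : 'I_n -> R * R) : simple_polygon p ->
  (forall j : 'I_n, ~ collinear (p j) (p (ordS j)) (p (ordS (ordS j)))) ->
  `|\sum_j vertex_turn p j| = 2 * pi.
Proof.
move=> sp nc; have pinj := simple_polygon_inj _ _ sp; have [n2 inj] := sp.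
case: n => [|[|N]] // in p sp nc pinj n2 inj *.
(* A vertex farthest from the origin is extremal: |u| <= |p i0| and u <> p i0 make the product of -
   p i0 with u - p i0 positive. *)
have [i0 _ far] := arg_maxP (fun i => dot (p i) (p i)) (erefl (xpredT (@ord0 N.+1))).
pose q j := p (iter j (@ordS N.+2) i0).
have qe j : q j.+1 - q j = edge p (iter j (@ordS N.+2) i0) by [].
have turnE j : turn (q j.+1 - q j) (q j.+2 - q j.+1) =
    vertex_turn p (iter j.+1 (@ordS N.+2) i0) by rewrite iterS vertex_turn_ordS.
have noncol (i : 'I_N.+2) : cross (edge p i) (edge p (ordS i)) != 0.
  apply/eqP => c0; apply: (nc i); rewrite /collinear -c0 /cross /edge /=; ring.
have qN : q N.+2 = q 0%N by rewrite /q iter_ordS_order.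
have qN1 : q N.+3 - q N.+2 = q 1%N - q 0%N.
  by rewrite !qe iter_ordS_order.
have := turning_number_at_extremal q (- p i0) N.
rewrite -(sum_iter_ordS N.+2 i0 (vertex_turn p)) big_ord_recr /= => <- //.
- by rewrite -qN1 turnE; congr `|_ + _|; apply: eq_bigr => i _; rewrite turnE.
- move=> i j l k iN jN l01 k01 E.
  have [] := inj (iter i (@ordS N.+2) i0) (iter j (@ordS N.+2) i0) l k l01 k01 E.
  by move=> /iter_ordS_inj -> .
- by move=> j _; rewrite !qe; exact: noncol.
- by rewrite -qN1 !qe; exact: noncol.
- move=> j j0 jN; set u := q j; have ne : u - p i0 != 0.
    rewrite subr_eq0; apply: contraTneq j0 => /pinj.
    by move/(@iter_ordS_inj N.+2 i0 j 0%N jN (ltn0Sn _)) ->.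
  have := far (iter j (@ordS N.+2) i0) isT; rewrite -/(q j) -/u => fu.
  have d0 : 0 < dot (u - p i0) (u - p i0) by rewrite -sqr_len exprn_gt0 // len_gt0.
  by move: d0 fu; rewrite /= /dot /=; lra.
Qed.

Lemma subset_sum_le n (A : pred 'I_n) (f : 'I_n -> R) :
  (forall i, `|f i| <= pi) -> `|\sum_i f i| <= 2 * pi ->
  `|\sum_(i | A i) f i| <= (n %/ 2 + 1)%:R * pi.
Proof.
move=> f1 f2; have p0 := @pi_ge0 R.
have H (B : pred 'I_n) : `|\sum_(i | B i) f i| <= #|B|%:R * pi.
  apply: le_trans (ler_norm_sum _ _ _) _.
  by rewrite mulr_natl -sumr_const; apply: ler_sum.
have cA : (#|A| + #|predC A| = n)%N by rewrite cardC card_ord.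
have [h|h] := leqP #|A| (n %/ 2 + 1)%N.
  by apply: le_trans (H A) _; apply: ler_wpM2r => //; rewrite ler_nat.
have -> : \sum_(i | A i) f i = \sum_i f i - \sum_(i | ~~ A i) f i.
  by rewrite [\sum_i f i](bigID A) /= addrK.
apply: le_trans (ler_normB _ _) _.
have := H (predC A) => {}H.
apply: le_trans (lerD f2 H) _; rewrite -mulrDl; apply: ler_wpM2r => //.
(* A has at least n / 2 + 2 elements, so 2 plus the size of its complement is at most n - n / 2. *)
by rewrite -natrD ler_nat; move: cA h; move: #|A| #|predC A| => a b; lia.
Qed.

Lemma turning_functionB n (p : 'I_n -> R * R) (i : 'I_n) (l s s' : R) : s' <= s ->
  turning_function p i l s - turning_function p i l s' =
  \sum_(k < n | (vertex_dist p i l k <= s) && ~~ (vertex_dist p i l k <= s'))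
     vertex_turn p (iter k.+1 (@ordS n) i).
Proof.
move=> ss; rewrite /turning_function.
rewrite [X in _ + X - _](bigID (fun k : 'I_n => vertex_dist p i l k <= s')) /=.
rewrite (eq_bigl (fun k : 'I_n => vertex_dist p i l k <= s')); first by ring.
by move=> k; case: (leP _ s') => [/le_trans /(_ ss) ->|]; rewrite ?andbF.
Qed.

Lemma function_span_le (phi : R -> R) (B : R) :
  (forall s s', 0 <= s <= 1 -> 0 <= s' <= 1 -> phi s - phi s' <= B) ->
  function_span phi <= B.
Proof.
move=> H; have ne : nonempty (phi @` `[0, 1])%classic.
  by exists (phi 0), 0 => //=; rewrite in_itv /= lexx ler01.
rewrite /function_span lerBlDr; apply: sup_le_ub => // _ [s + <-].
rewrite /= in_itv /= => s01; rewrite -lerBlDl; apply: lb_le_inf => // _ [s' + <-].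
by rewrite /= in_itv /= => s01'; have := H s s' s01 s01'; lra.
Qed.

Lemma turning_function_span_le n (p : 'I_n -> R * R) (i : 'I_n) (l : R) :
  simple_polygon p ->
  (forall j : 'I_n, ~ collinear (p j) (p (ordS j)) (p (ordS (ordS j)))) ->
  function_span (turning_function p i l) <= (n %/ 2 + 1)%:R * pi.
Proof.
move=> sp nc; apply: function_span_le => s s' _ _.
have K (A : pred 'I_n) :
    `|\sum_(k < n | A k) vertex_turn p (iter k.+1 (@ordS n) i)| <= (n %/ 2 + 1)%:R * pi.
  apply: subset_sum_le => [k|]; first exact: turn_le_pi.
  by rewrite sum_iter_ordS total_turn.
have [h|/ltW h] := leP s' s.
  by rewrite turning_functionB //; apply: le_trans (ler_norm _) (K _).
rewrite -opprB turning_functionB //; apply: le_trans (ler_norm _) _.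
by rewrite normrN; exact: K.
Qed.

End UpperBound.

(** * Compressed polygons *)

Section Squeeze.
Context {R : realType}.

(** Boundedness is what makes [sup] and [inf] actual bounds rather than default values. *)
Lemma function_span_ge (phi : R -> R) (B s s' : R) :
  (forall x, `|phi x| <= B) -> 0 <= s <= 1 -> 0 <= s' <= 1 ->
  phi s - phi s' <= function_span phi.
Proof.
move=> HB s01 s01'; have im x : 0 <= x <= 1 -> (phi @` `[0, 1])%classic (phi x).
  by move=> x01; exists x => //=; rewrite in_itv.
apply: lerB.
  apply: ub_le_sup; last exact: im.
  by exists B => _ [x _ <-]; apply: le_trans (ler_norm _) (HB x).
apply: ge_inf; last exact: im.
by exists (- B) => _ [x _ <-]; have := HB x; rewrite ler_norml => /andP[].
Qed.

Lemma turning_function_bounded n (p : 'I_n -> R * R) (i : 'I_n) (l s : R) :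
  `|turning_function p i l s| <= `|direction (edge p i)| + n%:R * pi.
Proof.
apply: le_trans (ler_normD _ _) _; rewrite lerD2l.
apply: le_trans (ler_norm_sum _ _ _) _.
apply: (@le_trans _ _ (\sum_(k < n | vertex_dist p i l k <= s) pi)).
  by apply: ler_sum => k _; exact: turn_le_pi.
rewrite sumr_const -[pi *+ _]mulr_natl; apply: ler_wpM2r; first exact: pi_ge0.
by rewrite ler_nat -[X in (_ <= X)%N]card_ord max_card.
Qed.

Lemma vertex_dist0 n (p : 'I_n -> R * R) (i : 'I_n) k :
  vertex_dist p i 0 k = \sum_(j < k.+1) len (edge p (iter j (@ordS n) i)).
Proof. by rewrite /vertex_dist subr0 mul1r big_ord_recl big_add1 big_mkord. Qed.

(** Edges of positive length make the vertex distances strictly increasing, from a positive first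
    one to the perimeter 1. So exactly the first k + 1 turns are added between s = 0 and the
    distance of index k. *)
Lemma turning_function_span_ge n (p : 'I_n -> R * R) (i : 'I_n) (k : nat) :
  (forall j, 0 < len (edge p j)) -> perimeter p = 1 -> (k < n)%N ->
  \sum_(j < k.+1) vertex_turn p (iter j.+1 (@ordS n) i)
    <= function_span (turning_function p i 0).
Proof.
move=> len0 per kn.
have lt_dist j : vertex_dist p i 0 j < vertex_dist p i 0 j.+1.
  by rewrite !vertex_dist0 [X in _ < X]big_ord_recr /= ltrDl.
have mono a b : (vertex_dist p i 0 a <= vertex_dist p i 0 b) = (a <= b)%N.
  exact: (Order.NatMonotonyTheory.incnP lt_dist).
have pos : 0 < vertex_dist p i 0 0 by rewrite vertex_dist0 big_ord1.
have dist1 : vertex_dist p i 0 k <= 1.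
  apply: (@le_trans _ _ (vertex_dist p i 0 n.-1)); first by rewrite mono; lia.
  rewrite vertex_dist0 prednK; last by lia.
  rewrite -per /perimeter -(sum_iter_ordS n (ord_pred i) (fun j => len (edge p j))).
  by apply: ler_sum => j _; rewrite iterSr ord_predK.
have -> : \sum_(j < k.+1) vertex_turn p (iter j.+1 (@ordS n) i) =
    turning_function p i 0 (vertex_dist p i 0 k) - turning_function p i 0 0.
  rewrite turning_functionB; last by rewrite (le_trans (ltW pos)) // mono.
  rewrite (big_ord_widen n (fun j => vertex_turn p (iter j.+1 (@ordS n) i)) kn).
  apply: eq_bigl => j; rewrite mono ltnS -ltNge andb_idr // => _.
  by rewrite (lt_le_trans pos) // mono.
apply: (function_span_ge _ _ _ _ (turning_function_bounded n p i 0)).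
  by rewrite dist1 andbT (le_trans (ltW pos)) // mono.
by rewrite lexx ler01.
Qed.

(** With X = |u.1 v.1|, the slopes give len u len v <= X (1 + a^2) and - dot u v >= X (1 - a^2).
    Since (1 - 2 a^2) (1 + a^2) <= 1 - a^2, the cosine of the turn is at most - cos eps. *)
Lemma turn_ge_near_pi (u v : R * R) (a eps : R) :
  0 < cross u v -> u.1 * v.1 < 0 -> 0 <= a ->
  `|u.2| <= a * `|u.1| -> `|v.2| <= a * `|v.1| ->
  2 * a ^+ 2 <= 1 - cos eps -> 0 <= eps <= pi / 2 ->
  pi - eps <= turn u v.
Proof.
move=> c0 uv a0 ua va ae /andP[e0 e1].
have ce : 0 <= cos eps by apply: cos_ge0_pihalf; rewrite e1 andbT (le_trans _ e0) // oppr_le0 divr_ge0 ?pi_ge0.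
have p0 := @pi_ge0 R.
have [uv0 uv0'] : u.1 != 0 /\ v.1 != 0.
  by split; apply/eqP => z; move: uv; rewrite z ?mul0r ?mulr0 ltxx.
have u0 : u != 0 by apply: contraNneq uv0 => ->.
have v0 : v != 0 by apply: contraNneq uv0' => ->.
have ll : 0 < len u * len v by rewrite mulr_gt0 ?len_gt0.
set r := Num.sqrt (1 + a ^+ 2).
have r2 : r ^+ 2 = 1 + a ^+ 2 by rewrite sqr_sqrtr // addr_ge0 ?sqr_ge0.
have lenle (w : R * R) : `|w.2| <= a * `|w.1| -> len w <= `|w.1| * r.
  move=> wa; rewrite -(@ler_pXn2r _ 2) ?nnegrE ?len_ge0 ?mulr_ge0 ?sqrtr_ge0 //.
  rewrite sqr_len exprMn r2 real_normK ?num_real // /dot -!expr2 mulrDr mulr1 lerD2l.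
  rewrite -[w.2 ^+ 2]real_normK ?num_real // -[w.1 ^+ 2]real_normK ?num_real //.
  by rewrite mulrC -exprMn ler_pXn2r ?nnegrE ?mulr_ge0.
set X := `|u.1| * `|v.1|; have X0 : 0 <= X by rewrite mulr_ge0.
have LL : len u * len v <= X * (1 + a ^+ 2).
  by rewrite -r2 expr2 mulrACA; apply: ler_pM; rewrite ?len_ge0 ?lenle.
have Y : `|u.2 * v.2| <= a ^+ 2 * X.
  by rewrite normrM expr2 mulrACA ler_pM.
have XE : u.1 * v.1 = - X by rewrite /X -normrM ltr0_norm // opprK.
have key : cos eps * (len u * len v) <= - dot u v.
  have a2 : 0 <= a ^+ 2 by exact: sqr_ge0.
  apply: (@le_trans _ _ ((1 - 2 * a ^+ 2) * (X * (1 + a ^+ 2)))).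
    by apply: ler_pM => //; [exact: ltW|lra].
  rewrite /dot XE; move: Y; rewrite ler_norml => /andP[_ Y].
  have : 0 <= X * (a ^+ 2 * a ^+ 2) by rewrite !mulr_ge0.
  by move: (a ^+ 2) Y => b; lra.
have cb := cos_vec_bound u v.
rewrite leNgt /turn gtr0_sg // mul1r; apply/negP => lt.
have : cos (pi - eps) < cos (acos (dot u v / (len u * len v))).
  rewrite ltr_cos // in_itv /= ?acos_ge0 ?acos_lepi //.
  by apply/andP; split; lra.
rewrite acosK ?in_itv //= addrC cosDpi cosN ltr_pdivlMr // mulNr; lra.
Qed.

Definition stretch (a b : R) n (p : 'I_n -> R * R) (i : 'I_n) : R * R :=
  (a * (p i).1, b * (p i).2).

Lemma edge_stretch a b n (p : 'I_n -> R * R) i :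
  edge (stretch a b n p) i = (a * (edge p i).1, b * (edge p i).2).
Proof. by rewrite /edge /stretch /= !mulrBr. Qed.

Lemma simple_stretch a b n (p : 'I_n -> R * R) : a != 0 -> b != 0 ->
  simple_polygon p -> simple_polygon (stretch a b n p).
Proof.
move=> a0 b0 [n2 H]; split => // i j l k l01 k01.
rewrite /edge_point !edge_stretch /= => -[E1 E2]; apply: H => //.
congr pair; [apply: (mulfI a0); move: E1|apply: (mulfI b0); move: E2].
  by rewrite !mulrDr !(mulrCA a).
by rewrite !mulrDr !(mulrCA b).
Qed.

Lemma counterclockwise_stretch a b n (p : 'I_n -> R * R) : 0 < a -> 0 < b ->
  counterclockwise p -> counterclockwise (stretch a b n p).
Proof.
move=> a0 b0 H; rewrite /counterclockwise /signed_area.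
rewrite (eq_bigr (fun i => a * b * cross (p i) (p (ordS i)))); last first.
  by move=> i _; rewrite /cross /=; ring.
by rewrite -mulr_sumr mulrCA mulr_gt0 // mulr_gt0.
Qed.

Lemma simple_polygon_len_gt0 n (p : 'I_n -> R * R) i :
  simple_polygon p -> 0 < len (edge p i).
Proof.
move=> sp; apply: len_gt0; rewrite subr_eq0; apply/eqP.
move=> /(simple_polygon_inj _ _ sp) /(congr1 val) /=; case: sp => n2 _.
have := ltn_ord i; have [/modn_small ->|le ilt] := ltnP i.+1 n; first by lia.
have -> : i.+1 = n by lia.
by rewrite modnn => i0; lia.
Qed.

(* Compressing the y-axis brings every turn that reverses the x-direction
   close to a half-turn. *)
Lemma squeezed_span n (p : 'I_n -> R * R) (i0 : 'I_n) (k : nat) (eps : R) :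
  simple_polygon p -> counterclockwise p -> (k < n)%N -> 0 < eps ->
  (forall j, (j <= k)%N ->
     0 < cross (edge p (iter j (@ordS n) i0)) (edge p (iter j.+1 (@ordS n) i0)) /\
     (edge p (iter j (@ordS n) i0)).1 * (edge p (iter j.+1 (@ordS n) i0)).1 < 0) ->
  exists P : 'I_n -> R * R, [/\ simple_polygon P, counterclockwise P, perimeter P = 1 &
    k.+1%:R * pi - eps <= function_span (turning_function P i0 0)].
Proof.
move=> sp ccw kn eps0 H.
(* The deficit allowed at each of the k + 1 turns; pi / 2 is the range of [turn_ge_near_pi]. *)
pose d := Num.min (eps / k.+1%:R) (pi / 2).
have d0 : 0 < d by rewrite lt_min divr_gt0 // ?divr_gt0 ?pi_gt0.
have d2 : d <= pi / 2 by rewrite ge_min lexx orbT.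
have dk : d * k.+1%:R <= eps by rewrite -ler_pdivlMr // ge_min lexx.
have cd : cos d < 1.
  rewrite -cos0 ltr_cos // in_itv /= ?lexx ?pi_ge0 // (ltW d0) (le_trans d2) //.
  by have := @pi_ge0 R; lra.
(* A sum of absolute slopes dominates each of them; a vertical edge contributes 0, the value of
   division by 0. *)
pose M : R := \sum_i `|(edge p i).2 / (edge p i).1|.
have M0 : 0 <= M by apply: sumr_ge0.
have slope i : (edge p i).1 != 0 -> `|(edge p i).2| <= M * `|(edge p i).1|.
  move=> e0; rewrite -ler_pdivrMr ?normr_gt0 // -normf_div /M (bigD1 i) //= lerDl.
  exact: sumr_ge0.
(* Compressed slopes are at most b M, and this b gives 2 (b M)^2 <= 1 - cos d; M + 1 keeps the
   denominator positive. *)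
pose b : R := Num.sqrt ((1 - cos d) / 2) / (M + 1).
have M1 : 0 < M + 1 by lra.
have b0 : 0 < b by rewrite divr_gt0 // sqrtr_gt0; lra.
have bN : b != 0 by rewrite gt_eqF.
pose L := perimeter (stretch 1 b n p).
have sb : simple_polygon (stretch 1 b n p).
  by apply: simple_stretch; rewrite ?oner_neq0.
have L0 : 0 < L.
  rewrite /L /perimeter (bigD1 i0) //= ltr_pwDl ?simple_polygon_len_gt0 //.
  by apply: sumr_ge0 => i _; exact: len_ge0.
have Li : 0 < L^-1 by rewrite invr_gt0.
pose P := stretch L^-1 (L^-1 * b) n p.
have sP : simple_polygon P.
  have LN : L^-1 != 0 by rewrite gt_eqF.
  by apply: simple_stretch => //; apply: mulf_neq0.
have pP : perimeter P = 1.
  rewrite -(mulVf (x := L)) ?gt_eqF // /L /perimeter mulr_sumr; apply: eq_bigr => i _.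
  rewrite !edge_stretch /len /dot /= mul1r.
  rewrite -[X in X * Num.sqrt _](ger0_norm (ltW Li)) -sqrtr_sqr -sqrtrM ?sqr_ge0 //.
  by congr Num.sqrt; ring.
exists P; split => //.
  by apply: counterclockwise_stretch => //; rewrite mulr_gt0.
have lenP j : 0 < len (edge P j) by exact: simple_polygon_len_gt0.
apply: le_trans (turning_function_span_ge n P i0 k lenP pP kn).
apply: (@le_trans _ _ (\sum_(j < k.+1) (pi - d))).
  by rewrite sumr_const card_ord -[(pi - d) *+ _]mulr_natl mulrBr lerD2l lerN2 mulrC.
apply: ler_sum => j _; rewrite iterS vertex_turn_ordS !edge_stretch.
have jk : (j <= k)%N by rewrite -ltnS ltn_ord.
have [] := H j jk; rewrite iterS; set e := edge p _; set e' := edge p _ => c0 x0.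
have [e1 e1'] : e.1 != 0 /\ e'.1 != 0.
  by split; apply/eqP => z; move: x0; rewrite z ?mul0r ?mulr0 ltxx.
have := slope _ e1; have := slope _ e1'; rewrite -/e -/e' => se' se.
have scaled (a c x y : R) : 0 < a -> 0 < c -> `|x| <= M * `|y| ->
    `|a * c * x| <= c * M * `|a * y|.
  move=> a0 c1 xy; rewrite !normrM (gtr0_norm a0) (gtr0_norm c1) -!mulrA mulrCA.
  by rewrite (mulrCA M) !ler_pM2l.
clearbody e e'; apply: (turn_ge_near_pi _ _ (b * M)) => /=.
- rewrite /cross /= (_ : _ - _ = L^-1 * (L^-1 * b) * cross e e'); last by rewrite /cross; ring.
  exact: (mulr_gt0 (mulr_gt0 Li (mulr_gt0 Li b0)) c0).
- by rewrite mulrACA pmulr_rlt0 // mulr_gt0.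
- by rewrite mulr_ge0 // ltW.
- exact: scaled.
- exact: scaled.
- have B2 : (b * (M + 1)) ^+ 2 = (1 - cos d) / 2.
    by rewrite mulfVK ?gt_eqF // sqr_sqrtr //; lra.
  have : (b * M) ^+ 2 <= (b * (M + 1)) ^+ 2.
    have bM : 0 <= b * M by apply: mulr_ge0 => //; exact: ltW.
    have le : b * M <= b * (M + 1) by apply: ler_wpM2l; [exact: ltW|lra].
    by apply: lerXn2r => //; rewrite nnegrE // (le_trans bM).
  rewrite B2; lra.
- by rewrite (ltW d0).
Qed.

End Squeeze.

(** * A doubled spiral *)

Section Spiral.
Context {R : realType}.

(** Twice the signed area of the triangle a b c, positive when c is to the left of the line from a
    to b. *)
Definition orient (a b c : R * R) : R := cross (b - a) (c - a).

Lemma orient_rot a b c : orient b c a = orient a b c.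
Proof. by rewrite /orient /cross /=; ring. Qed.

Lemma orient_swap a b c : orient b a c = - orient a b c.
Proof. by rewrite /orient /cross /=; ring. Qed.

Lemma cross_edge n (p : 'I_n -> R * R) i :
  cross (edge p i) (edge p (ordS i)) = orient (p i) (p (ordS i)) (p (ordS (ordS i))).
Proof. by rewrite /orient /cross /edge /=; ring. Qed.

Definition same_side (a b c d : R * R) : Prop := 0 < orient a b c * orient a b d.

(** The orientation relative to the line a b is affine along the segment c d and has one strict sign
    at its ends, so the segment misses the whole line; hence l is arbitrary. *)
Lemma same_side_segment a b c d (l k : R) : same_side a b c d -> 0 <= k < 1 ->
  (a.1 + l * (b - a).1, a.2 + l * (b - a).2) <>
  (c.1 + k * (d - c).1, c.2 + k * (d - c).2).
Proof.
move=> s /andP[k0 k1] [E1 E2].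
have : (1 - k) * orient a b c + k * orient a b d = 0.
  transitivity ((b - a).1 * (c.2 + k * (d - c).2 - (a.2 + l * (b - a).2)) -
                (b - a).2 * (c.1 + k * (d - c).1 - (a.1 + l * (b - a).1))).
    by rewrite /orient /cross /=; ring.
  by rewrite -E1 -E2 !subrr !mulr0 subrr.
move: s; rewrite /same_side; move: (orient a b c) (orient a b d) => x y xy E.
have x0 : 0 < (1 - k) * (x * x).
  rewrite mulr_gt0 ?subr_gt0 // -expr2 lt_def sqr_ge0 andbT sqrf_eq0.
  by apply: contraTneq xy => ->; rewrite mul0r ltxx.
have : 0 = (1 - k) * (x * x) + k * (x * y) by rewrite -(mul0r x) -E; ring.
by have := mulr_ge0 k0 (ltW xy); lra.
Qed.

(** Adjacent edges are not parallel, so their lines meet only at the shared vertex, which the first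
    half-open edge omits. Other pairs of distinct edges are separated by the line of one of them. *)
Lemma simple_polygon_of_orient n (p : 'I_n -> R * R) : (2 < n)%N ->
  (forall i, orient (p i) (p (ordS i)) (p (ordS (ordS i))) != 0) ->
  (forall i j, i != j -> j != ordS i -> i != ordS j ->
     same_side (p i) (p (ordS i)) (p j) (p (ordS j)) \/
     same_side (p j) (p (ordS j)) (p i) (p (ordS i))) ->
  simple_polygon p.
Proof.
move=> n2 nc sep; split => // i j l k l01 k01 E.
have adj x (s t : R) : 0 <= s < 1 -> edge_point p x s <> edge_point p (ordS x) t.
  move=> /andP[s0 s1] [E1 E2]; have /eqP := nc x; apply.
  have : (1 - s) * orient (p x) (p (ordS x)) (p (ordS (ordS x))) = 0.
    rewrite -cross_edge.
    transitivity (((p (ordS x)).1 + t * (edge p (ordS x)).1 - ((p x).1 + s * (edge p x).1)) * (edge p (ordS x)).2 -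
       ((p (ordS x)).2 + t * (edge p (ordS x)).2 - ((p x).2 + s * (edge p x).2)) * (edge p (ordS x)).1).
      by rewrite /cross {1 2 3 4}/edge /edge /=; ring.
    by rewrite -E1 -E2 !subrr !mul0r subrr.
  by move/eqP; rewrite mulf_eq0 subr_eq0 gt_eqF //= => /eqP.
have [ij|ij] := eqVneq i j; last have [ji|ji] := eqVneq j (ordS i).
- split=> //; subst j; move: E => [/addrI E1 /addrI E2]; apply/eqP.
  rewrite -subr_eq0; have : (l - k) * cross (edge p i) (edge p (ordS i)) = 0.
    transitivity ((l * (edge p i).1 - k * (edge p i).1) * (edge p (ordS i)).2 -
                  (l * (edge p i).2 - k * (edge p i).2) * (edge p (ordS i)).1).
      by rewrite /cross; ring.
    by rewrite E1 E2 !subrr !mul0r subrr.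
  by move/eqP; rewrite cross_edge mulf_eq0 (negbTE (nc i)) orbF.
- by subst j; case: (adj i l k l01 E).
have [ij'|ij'] := eqVneq i (ordS j).
  by subst i; case: (adj j k l k01 (esym E)).
have [s|s] := sep i j ij ji ij'.
  by case: (same_side_segment _ _ _ _ l k s k01 E).
by case: (same_side_segment _ _ _ _ k l s l01 (esym E)).
Qed.

(* Each ray is the previous one turned counterclockwise by less than a half-turn,
   so that points at increasing distance on successive rays spiral outwards. *)
Definition ray (j : nat) (r : R) : R * R := ((-1) ^+ j * r, - ((-1) ^+ j * r * j%:R)).

Lemma cross_rayS j r r' : cross (ray j r) (ray j.+1 r') = r * r'.
Proof.
rewrite /cross /ray /= exprS -natr1.
rewrite (_ : _ - _ = ((-1) ^+ j * (-1) ^+ j) * (r * r')); last by ring.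
by rewrite -expr2 sqrr_sign mul1r.
Qed.

(** Only the gap q matters. For positive radii the value is positive when q is odd; when q is even,
    r and r' must outgrow z. *)
Lemma orient_ray_before i q r r' z :
  orient (ray (i + q) r) (ray (i + q).+1 r') (ray i z) =
  r * r' - (-1) ^+ q * z * (r' * q.+1%:R + r * q%:R).
Proof.
rewrite /orient /cross /ray /= exprS !exprD -!natr1 !natrD.
have : ((-1) ^+ i * (-1) ^+ i = 1 :> R)%R by rewrite -expr2 sqrr_sign.
have : ((-1) ^+ q * (-1) ^+ q = 1 :> R)%R by rewrite -expr2 sqrr_sign.
move: ((-1) ^+ i) ((-1) ^+ q) => x y yy xx.
transitivity ((x * x) * (y * y) * (r * r') -
    (x * x) * (y * z * (r' * (q%:R + 1) + r * q%:R))); first by ring.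
by rewrite xx yy !mul1r.
Qed.

Lemma orient_ray_left j r r' z : 0 < r' -> z < r ->
  0 < orient (ray j r) (ray j.+1 r') (ray j z).
Proof.
move=> r0 zr; have := orient_ray_before j 0 r r' z; rewrite addn0 => ->.
rewrite expr0; nra.
Qed.

Lemma orient_ray_right j r r' z : 0 < r -> z < r' ->
  0 < orient (ray j r) (ray j.+1 r') (ray j.+1 z).
Proof.
move=> r0 zr.
rewrite (_ : orient _ _ _ = r * (r' - z)) ?mulr_gt0 ?subr_gt0 //.
rewrite /orient /cross /ray /= !exprS -natr1.
have : ((-1) ^+ j * (-1) ^+ j = 1 :> R)%R by rewrite -expr2 sqrr_sign.
move: ((-1) ^+ j) => x xx.
by transitivity ((x * x) * (r * (r' - z))); [ring|rewrite xx mul1r].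
Qed.

Lemma orient_ray_succ j r r' z : 0 < r -> 0 < r' -> 0 < z ->
  0 < orient (ray j r) (ray j.+1 r') (ray j.+2 z).
Proof.
move=> r0 r0' z0.
rewrite (_ : orient _ _ _ = r * r' + r' * z + 2 * (r * z)) ?addr_gt0 ?mulr_gt0 //.
rewrite /orient /cross /ray /= !exprS -[j.+2%:R]natr1 -[j.+1%:R]natr1.
have : ((-1) ^+ j * (-1) ^+ j = 1 :> R)%R by rewrite -expr2 sqrr_sign.
move: ((-1) ^+ j) => x xx.
by transitivity ((x * x) * (r * r' + r' * z + 2 * (r * z))); [ring|rewrite xx mul1r].
Qed.

(** The growth that base 4 provides at even gaps q >= 2; the leading factor 2 pays for the halved
    inner radii. *)
Lemma ltn_expn4 q : (1 < q)%N -> (2 * (2 * q).+1 < 4 ^ q)%N.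
Proof.
elim: q => [//|[//|[//|q]] IH] _; rewrite expnS.
by have := IH isT; lia.
Qed.

(** [4 ^+ j <= 2 * r] covers outer and halved inner radii alike. For an even gap q, z (r' (q + 1) +
    r q) <= z r' (2 q + 1) < r r'. *)
Lemma orient_ray_earlier i j r r' z : (i < j)%N ->
  4 ^+ j <= 2 * r -> r <= r' -> 0 < z -> z <= 4 ^+ i ->
  0 < orient (ray j r) (ray j.+1 r') (ray i z).
Proof.
move=> ij jr rr z0 zi; have := orient_ray_before i (j - i) r r' z.
rewrite subnKC; last exact: ltnW.
move=> ->; set q := (j - i)%N; have q0 : (0 < q)%N by rewrite subn_gt0.
have r0 : 0 < r by have : 0 < 4 ^+ j :> R by [exact: exprn_gt0]; lra.
have r0' : 0 < r' by apply: lt_le_trans rr.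
have w0 : 0 < r' * q.+1%:R + r * q%:R by rewrite addr_gt0 // mulr_gt0 // ltr0n.
rewrite -signr_odd; case: (boolP (odd q)) => oq.
  by rewrite expr1 mulN1r mulNr opprK addr_gt0 // mulr_gt0.
rewrite expr0 mul1r subr_gt0.
have q1 : (1 < q)%N by case: (q) q0 oq => [|[]].
have zr : z * (2 * q).+1%:R < r.
  have : (2 * (2 * q).+1)%:R < (4 ^ q)%:R :> R by rewrite ltr_nat ltn_expn4.
  rewrite natrM natrX => lt4.
  have ei : 0 < 4 ^+ i :> R by exact: exprn_gt0.
  have ej : 4 ^+ j = 4 ^+ i * 4 ^+ q :> R by rewrite -exprD subnKC // ltnW.
  have : z * (2 * q).+1%:R <= 4 ^+ i * (2 * q).+1%:R by apply: ler_wpM2r.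
  have : 4 ^+ i * (2 * (2 * q).+1%:R) < 4 ^+ i * 4 ^+ q :> R by rewrite ltr_pM2l.
  by rewrite -ej; lra.
have : z * (2 * q).+1%:R * r' < r * r' by rewrite ltr_pM2r.
apply: le_lt_trans; rewrite -mulrA; apply: ler_wpM2l; first exact: ltW.
have : r * q%:R <= r' * q%:R by apply: ler_wpM2r.
by rewrite -!natr1 natrM; lra.
Qed.

(** * The spiral polygon with 2 k vertices *)

Section Polygon.
Context (k : nat) (k1 : (1 < k)%N).

Definition outer_radius (j : nat) : R := 4 ^+ j.
Definition inner_radius (j : nat) : R :=
  if (0 < j < k)%N then 4 ^+ j / 2 else 4 ^+ j.

(* Out along the outer arm of the spiral, back along the inner one; the arms
   share their endpoints. *)
Definition spiral (v : nat) : R * R :=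
  if (v <= k)%N then ray v (outer_radius v) else ray (k + k - v) (inner_radius (k + k - v)).

Lemma outer_gt0 j : 0 < outer_radius j.
Proof. exact: exprn_gt0. Qed.

Lemma inner_gt0 j : 0 < inner_radius j.
Proof.
have := outer_gt0 j; rewrite /outer_radius /inner_radius.
by case: ifP => _ ? //; lra.
Qed.

Lemma inner_le_outer j : inner_radius j <= outer_radius j.
Proof.
have := outer_gt0 j; rewrite /outer_radius /inner_radius.
by case: ifP => _ ? //; lra.
Qed.

Lemma inner_lt_outer j : (0 < j < k)%N -> inner_radius j < outer_radius j.
Proof.
have := outer_gt0 j; rewrite /outer_radius /inner_radius => ? ->; lra.
Qed.

Lemma outer_le2_inner j : outer_radius j <= 2 * inner_radius j.
Proof.
have := outer_gt0 j; rewrite /outer_radius /inner_radius.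
by case: ifP => _ ? //; lra.
Qed.

Lemma outer_leS j : outer_radius j <= outer_radius j.+1.
Proof. by have := outer_gt0 j; rewrite /outer_radius exprS; lra. Qed.

Lemma inner_leS j : inner_radius j <= inner_radius j.+1.
Proof.
have := inner_le_outer j; have := outer_le2_inner j.+1; have := outer_gt0 j.
by rewrite /outer_radius exprS; lra.
Qed.

Lemma spiral_outer v : (v <= k)%N -> spiral v = ray v (outer_radius v).
Proof. by rewrite /spiral => ->. Qed.

Lemma spiral_inner j : (j <= k)%N -> spiral (k + k - j) = ray j (inner_radius j).
Proof.
move=> jk; rewrite /spiral; case: leqP => h; last by rewrite subKn //; lia.
have -> : j = k by lia.
by rewrite addnK /inner_radius ltnn andbF.
Qed.

Lemma spiral_period : spiral (k + k) = spiral 0.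
Proof.
have := spiral_inner 0 (leq0n k); rewrite subn0 => ->.
by rewrite spiral_outer.
Qed.

Lemma spiral_edge v : (v < k + k)%N ->
  (v < k)%N \/ exists2 j, (j < k)%N & v = (k + k - j.+1)%N.
Proof.
move=> vk; have [|h] := ltnP v k; [by left|right].
by exists (k + k - v.+1)%N; lia.
Qed.

Lemma outer_before i j z : (i < j)%N -> 0 < z -> z <= outer_radius i ->
  0 < orient (ray j (outer_radius j)) (ray j.+1 (outer_radius j.+1)) (ray i z).
Proof.
move=> ij; apply: orient_ray_earlier => //; last exact: outer_leS.
by have := outer_gt0 j; rewrite /outer_radius; lra.
Qed.

Lemma inner_before i j z : (i < j)%N -> 0 < z -> z <= outer_radius i ->
  0 < orient (ray j (inner_radius j)) (ray j.+1 (inner_radius j.+1)) (ray i z).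
Proof.
by move=> ij; apply: orient_ray_earlier => //; [exact: outer_le2_inner|exact: inner_leS].
Qed.

Lemma same_sideC a b c d : same_side a b c d -> same_side b a d c.
Proof. by rewrite /same_side !(orient_swap a b) mulrNN mulrC. Qed.

Lemma same_sideCr a b c d : same_side a b c d -> same_side a b d c.
Proof. by rewrite /same_side mulrC. Qed.

(** The line of an edge has all points of earlier rays on one side, which settles two edges on the
    same arm or far apart. An outer edge also has the strictly inner points of its own two rays on
    that side, which settles edges of different arms on common rays. *)
Lemma spiral_separated v w : (v.+1 < w)%N -> (w < k + k)%N ->
  ~~ ((v == 0%N) && (w == (k + k).-1)) ->
  same_side (spiral v) (spiral v.+1) (spiral w) (spiral w.+1) \/
  same_side (spiral w) (spiral w.+1) (spiral v) (spiral v.+1).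
Proof.
move=> vw wk nadj.
have o0 := outer_gt0; have i0 := inner_gt0; have io := inner_le_outer.
have innerS j : (j < k)%N -> (k + k - j.+1).+1 = (k + k - j)%N by lia.
have [wk'|[j jk wE]] := spiral_edge w wk.
  right; rewrite !spiral_outer; try lia.
  by apply: mulr_gt0; apply: outer_before => //; lia.
have [vk|[i ik vE]] := spiral_edge v (ltn_trans (ltnW vw) wk); last first.
  left; rewrite wE vE !innerS // !spiral_inner //; try lia.
  apply: same_sideC; apply: mulr_gt0; apply: inner_before => //; lia.
rewrite wE !innerS // !spiral_inner ?spiral_outer // ; try lia.
have [vj|jv|vj] := ltngtP v j.
- have [vj'|vj'] := leqP v.+2 j.
    right; apply/same_sideC/same_sideCr.
    by apply: mulr_gt0; apply: inner_before => //; lia.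
  have jE : j = v.+1 by lia.
  left; rewrite jE; apply: mulr_gt0.
    by apply: orient_ray_succ.
  by apply: orient_ray_right => //; apply: inner_lt_outer; lia.
- left; apply: mulr_gt0; last by apply: outer_before.
  have [jv'|jv'] := leqP j.+2 v; first by apply: outer_before.
  have -> : j.+1 = v by lia.
  by apply: orient_ray_left => //; apply: inner_lt_outer; lia.
(* Both edges join the rays j and j + 1. The arms meet on the rays 0 and k, and nonadjacency
   excludes j = 0 and j + 1 = k, so the inner radii are strictly smaller. *)
- left; rewrite vj; apply: mulr_gt0.
    by apply: orient_ray_right => //; apply: inner_lt_outer; lia.
  by apply: orient_ray_left => //; apply: inner_lt_outer; lia.
Qed.

(** These are the turns at the vertices 1 to k. At the tip k the path comes back to the inner point
    of ray k - 1, left of the last outer edge. *)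
Lemma spiral_left_turn v : (v < k)%N -> 0 < orient (spiral v) (spiral v.+1) (spiral v.+2).
Proof.
move=> vk; have o0 := outer_gt0; have i0 := inner_gt0.
have [vk'|vk'] := leqP v.+2 k.
  by rewrite !spiral_outer; try lia; apply: orient_ray_succ.
rewrite (_ : v.+2 = (k + k - v)%N) ?spiral_inner ?spiral_outer; try lia.
by apply: orient_ray_left => //; apply: inner_lt_outer; lia.
Qed.

Lemma spiral_left_turn0 : 0 < orient (spiral (k + k).-1) (spiral 0) (spiral 1).
Proof.
rewrite -orient_rot -subn1 spiral_inner ?spiral_outer; try lia.
by apply: orient_ray_right; rewrite ?outer_gt0 // inner_lt_outer.
Qed.

Lemma spiral_right_turn v : (k <= v)%N -> (v.+1 < k + k)%N ->
  orient (spiral v) (spiral v.+1) (spiral v.+2) < 0.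
Proof.
move=> kv vk; have [j jk vE] : exists2 j, (j.+2 <= k)%N & v = (k + k - j.+2)%N.
  by exists (k + k - v.+2)%N; lia.
rewrite vE (_ : (k + k - j.+2).+1 = k + k - j.+1)%N; last by lia.
rewrite (_ : (k + k - j.+1).+1 = k + k - j)%N; last by lia.
rewrite !spiral_inner; try lia.
by rewrite orient_swap orient_rot oppr_lt0 orient_ray_succ ?inner_gt0.
Qed.

Definition spiral_polygon (i : 'I_(k + k)) : R * R := spiral i.

Lemma spiral_ordS i : spiral_polygon (ordS i) = spiral i.+1.
Proof.
rewrite /spiral_polygon /=; have := ltn_ord i.
have [h _|h h'] := ltnP i.+1 (k + k)%N; first by rewrite modn_small.
have -> : i.+1 = (k + k)%N by lia.
by rewrite modnn spiral_period.
Qed.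

(** Successive rays lie on opposite sides of the y-axis, on either arm; the sign is consistent
    around the cycle because its length 2 k is even. *)
Lemma spiral_edge_x v : (v < k + k)%N ->
  exists2 t, 0 < t & (spiral v.+1 - spiral v).1 = (-1) ^+ v.+1 * t.
Proof.
move=> vk; have [vk'|[j jk vE]] := spiral_edge v vk.
  exists (outer_radius v.+1 + outer_radius v); first by rewrite addr_gt0 ?outer_gt0.
  by rewrite !spiral_outer //= ?exprS; [ring|lia].
exists (inner_radius j.+1 + inner_radius j); first by rewrite addr_gt0 ?inner_gt0.
have -> : (-1) ^+ v.+1 = (-1) ^+ j :> R.
  rewrite -signr_odd -[RHS]signr_odd vE; congr (_ ^+ nat_of_bool _).
  rewrite (_ : (k + k - j.+1).+1 = k + k - j)%N; last by lia.
  by rewrite oddB ?addnn ?odd_double //; lia.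
rewrite vE (_ : (k + k - j.+1).+1 = k + k - j)%N; last by lia.
by rewrite !spiral_inner //= ?exprS; [ring|lia].
Qed.

Lemma spiral_polygon_turn i :
  orient (spiral_polygon i) (spiral_polygon (ordS i)) (spiral_polygon (ordS (ordS i))) != 0.
Proof.
rewrite !spiral_ordS /=; have ilt := ltn_ord i; rewrite /spiral_polygon.
have [h|h] := ltnP i.+1 (k + k)%N.
  rewrite modn_small //; have [ik|ik] := ltnP i k.
    by rewrite gt_eqF // spiral_left_turn.
  by rewrite lt_eqF // spiral_right_turn.
have E : i.+1 = (k + k)%N by lia.
by rewrite E modnn spiral_period -[nat_of_ord i]/(i.+1.-1) E gt_eqF // spiral_left_turn0.
Qed.

Lemma spiral_simple : simple_polygon spiral_polygon.
Proof.
apply: simple_polygon_of_orient; [lia|exact: spiral_polygon_turn|].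
have H (i j : 'I_(k + k)) : (i < j)%N -> j != ordS i -> i != ordS j ->
     same_side (spiral_polygon i) (spiral_polygon (ordS i)) (spiral_polygon j) (spiral_polygon (ordS j)) \/
     same_side (spiral_polygon j) (spiral_polygon (ordS j)) (spiral_polygon i) (spiral_polygon (ordS i)).
  move=> ij /eqP nji /eqP nij; rewrite !spiral_ordS; apply: spiral_separated => //.
    rewrite ltn_neqAle ij andbT; apply/eqP => e; apply: nji; apply: val_inj => /=.
    by rewrite e modn_small // ltn_ord.
  apply/negP => /andP[/eqP e0 /eqP e1]; apply: nij; apply: val_inj => /=.
  by rewrite e1 prednK ?modnn //; lia.
move=> i j; rewrite neq_ltn => /orP[ij|ji] h1 h2; first exact: H.
by have [] := H j i ji h2 h1; [right|left].
Qed.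

(** The outer and inner edges between the rays i and i + 1 are paired: together they contribute the
    outer product of radii minus the inner one, strictly positive at i = 0. *)
Lemma spiral_counterclockwise : counterclockwise spiral_polygon.
Proof.
rewrite /counterclockwise /signed_area mulr_gt0 // big_split_ord /=.
rewrite [X in _ + X](reindex_inj rev_ord_inj) /= -big_split /=.
have term (i : 'I_k) : cross (spiral_polygon (lshift k i)) (spiral_polygon (ordS (lshift k i))) +
   cross (spiral_polygon (rshift k (rev_ord i))) (spiral_polygon (ordS (rshift k (rev_ord i)))) =
   outer_radius i * outer_radius i.+1 - inner_radius i * inner_radius i.+1.
  have := ltn_ord i; rewrite !spiral_ordS /spiral_polygon /= => ik.
  rewrite (_ : (k + (k - i.+1) = k + k - i.+1)%N); last by lia.
  rewrite (_ : (k + k - i.+1).+1 = (k + k - i)%N); last by lia.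
  rewrite !spiral_inner ?spiral_outer; try lia.
  by rewrite cross_rayS crossC cross_rayS.
rewrite (eq_bigr _ (fun i _ => term i)).
have term_ge0 (i : 'I_k) : 0 <= outer_radius i * outer_radius i.+1 - inner_radius i * inner_radius i.+1.
  by rewrite subr_ge0 ler_pM ?inner_le_outer ?ltW ?inner_gt0.
rewrite (bigD1 (Ordinal (ltnW k1))) //= ltr_pwDl //; last by apply: sumr_ge0.
rewrite subr_gt0 /inner_radius /outer_radius /= k1 expr0 expr1; lra.
Qed.

Lemma spiral_span (eps : R) : 0 < eps ->
  exists (P : 'I_(k + k) -> R * R) (i : 'I_(k + k)),
    [/\ simple_polygon P, counterclockwise P, perimeter P = 1 &
      k.+1%:R * pi - eps <= function_span (turning_function P i 0)].
Proof.
move=> eps0; have lt : ((k + k).-1 < k + k)%N by lia.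
(* Starting at the last vertex, the first k + 1 turns are those at the vertices 0 to k, all of them
   left turns. *)
pose i0 := Ordinal lt.
have val0 j : (j < k + k)%N -> iter j.+1 (@ordS (k + k)) i0 = j :> nat.
  move=> jk; rewrite val_iter_ordS /= (_ : (_ + _ = k + k + j)%N); last by lia.
  by rewrite modnDl modn_small.
have [|j jk|P HP] := squeezed_span _ _ i0 k eps spiral_simple spiral_counterclockwise _ eps0.
- lia.
- rewrite iterS cross_edge /edge !spiral_ordS.
  have vS (x : 'I_(k + k)) : ordS x = (x.+1 %% (k + k))%N :> nat by [].
  rewrite /spiral_polygon vS; case: j jk => [_|j jk].
    rewrite [nat_of_ord (iter _ _ _)]/=; rewrite prednK ?modnn ?spiral_period; last by lia.
    split; first exact: spiral_left_turn0.
    have [s s0] := spiral_edge_x _ lt; have [|t t0] := spiral_edge_x 0; first by lia.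
    rewrite prednK ?spiral_period; last by lia.
    rewrite expr1 => /= -> ->; rewrite addnn -signr_odd odd_double expr0; nra.
  rewrite (val0 j); last by lia.
  rewrite modn_small; last by lia.
  split; first exact: spiral_left_turn.
  have [|s s0] := spiral_edge_x j; first by lia.
  have [|t t0] := spiral_edge_x j.+1; first by lia.
  have alt : (-1) ^+ j.+1 * (-1) ^+ j.+2 = -1 :> R.
    by rewrite (exprS _ j.+1) mulrCA -expr2 sqrr_sign mulr1.
  by rewrite /= => -> ->; rewrite mulrACA alt mulN1r oppr_lt0 mulr_gt0.
by exists P, i0.
Qed.

End Polygon.
End Spiral.

(** * The case m = 3 and the conclusion *)

Definition triangle {R : realType} (i : 'I_3) : R * R :=
  if val i == 0%N then (-1, 0) else if val i == 1%N then (1, 0) else (0, 1).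

(** The spiral needs k >= 2, hence m >= 4. For m = 3, the two turns at the ends of a horizontal base
    reverse the x-direction. *)
Lemma triangle_span {R : realType} (eps : R) : 0 < eps ->
  exists (P : 'I_3 -> R * R) (i : 'I_3),
    [/\ simple_polygon P, counterclockwise P, perimeter P = 1 &
      2 * pi - eps <= function_span (turning_function P i 0)].
Proof.
move=> eps0.
have sp : simple_polygon (@triangle R).
  apply: simple_polygon_of_orient => // [[[|[|[|//]]] i3]|[[|[|[|//]]] i3] [[|[|[|//]]] j3]] //.
  - by rewrite /orient /cross /triangle /=; apply/eqP; lra.
  - by rewrite /orient /cross /triangle /=; apply/eqP; lra.
  - by rewrite /orient /cross /triangle /=; apply/eqP; lra.
have ccw : counterclockwise (@triangle R).
  rewrite /counterclockwise /signed_area !big_ord_recl big_ord0 /cross /triangle /=; lra.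
have [//|[|[|//]] _|P HP] := squeezed_span 3 _ ord_max 1 eps sp ccw _ eps0.
- by rewrite /edge /cross /triangle /=; split; lra.
- by rewrite /edge /cross /triangle /=; split; lra.
by exists P, ord_max.
Qed.

Theorem theoremC2 (R : realType) (m : nat) (hm : (2 < m)%N) :
  (forall (Q : 'I_m -> R * R) (i : 'I_m) (l : R),
     simple_polygon Q -> counterclockwise Q -> perimeter Q = 1 ->
     (forall j : 'I_m, ~ collinear (Q j) (Q (ordS j)) (Q (ordS (ordS j)))) ->
     0 <= l < 1 ->
     function_span (turning_function Q i l) <= (m %/ 2 + 1)%:R * pi) /\
  (forall eps : R, 0 < eps ->
     exists (n : nat) (P : 'I_n -> R * R) (i : 'I_n) (l : R),
       (n <= m)%N /\ simple_polygon P /\ counterclockwise P /\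
       perimeter P = 1 /\ 0 <= l < 1 /\
       (m %/ 2 + 1)%:R * pi - eps <= function_span (turning_function P i l)).
Proof.
split=> [Q i l sQ _ _ nc _|eps eps0]; first exact: turning_function_span_le.
have l0 : 0 <= (0 : R) < 1 by rewrite lexx ltr01.
have [m3|m3] := leqP m 3.
  have [P [i [sP cP pP span]]] := triangle_span eps eps0.
  have -> : (m %/ 2 + 1 = 2)%N by lia.
  by exists 3, P, i, 0.
have k1 : (1 < m %/ 2)%N by lia.
have [P [i [sP cP pP span]]] := spiral_span (m %/ 2) k1 eps eps0.
(* For odd m the spiral has m - 1 vertices. *)
have le_m : (m %/ 2 + m %/ 2 <= m)%N by lia.
by exists (m %/ 2 + m %/ 2)%N, P, i, 0; rewrite addn1.
Qed.
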